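(* Let $G$ be a finite group and $H$ a subgroup of $G$. If the core of $H$ in $G$ is not contained in the center of $G$, then there is no connected Cayley sum graph of $G$ admitting $H$ as a total perfect code.
   Context: All groups are finite. A subset $Y$ of $G$ is normal if $g^{-1}Yg=Y$ for all $g\in G$. For a normal subset $Y$ of $G$, the Cayley sum graph $\mathrm{CS}(G,Y)$ is the simple graph with vertex set $G$ in which distinct vertices $g,h$ are adjacent iff $gh\in Y$. A total perfect code in a graph is a set $C$ of vertices such that every vertex has exactly one neighbour in $C$. The core of $H$ in $G$ is the largest normal subgroup of $G$ contained in $H$. *)

(* Defs.v *)
From mathcomp Require Import all_boot all_fingroup all_solvable.

Set Implicit Arguments.
Unset Strict Implicit.
Unset Printing Implicit Defensive.

Local Open Scope group_scope.

Section Graph.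

(* A graph is given by its vertex set V and an adjacency relation e whose
   edges are expected to have both endpoints in V. *)
Variables (T : finType) (V : {set T}) (e : rel T).

Definition graph_connected : Prop := {in V &, forall x y, connect e x y}.

Definition total_perfect_code (C : {set T}) : Prop :=
  C \subset V /\ {in V, forall v, #|[set c in C | e v c]| = 1%N}.

End Graph.

Section CayleySum.

Variable gT : finGroupType.
Implicit Types G Y : {set gT}.

(* Y is not required to be a subgroup; Y :^ g = g^-1 Y g. *)
Definition normal_subset G Y : Prop :=
  Y \subset G /\ {in G, forall g, Y :^ g = Y}.

(* Vertex set G; symmetric on G when Y is a normal subset of G. *)
Definition cayley_sum G Y : rel gT :=
  [rel g h | [&& g \in G, h \in G, g != h & g * h \in Y]].

End CayleySum.

(* Main.v *)
Require Import Defs.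
From mathcomp Require Import all_boot all_fingroup all_solvable.

(** Let N be the core of H. For y in Y and n in N, both y and y ^ n = y * [~ y, n]
    lie in Y, and [~ y, n] lies in N, hence in H. So the uniqueness of a neighbour
    in H (of the vertex 1 if y is in H, of the vertex y otherwise) forces
    y ^ n = y. Thus Y centralises N, and since a connected Cayley sum graph has
    G = <<Y>>, the whole of G centralises N. *)

Local Open Scope group_scope.

(** If [g * h] lies in [<<Y>>], then [g] and [h] both lie in [<<Y>>] or both lie outside, so [<<Y>>]
    is a union of connected components; it contains [1]. *)
Lemma connected_cayley_sum_gen {gT : finGroupType} {G : {group gT}}
    {Y : {set gT}} :
  graph_connected G (cayley_sum G Y) -> G \subset <<Y>>.
Proof.
move=> conG; apply/subsetP=> x Gx.
have clY: closed (cayley_sum G Y) <<Y>>.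
  move=> g h /and4P[_ _ _ /mem_gen Ygh].
  by apply/idP/idP=> Y_; [rewrite groupMl in Ygh | rewrite groupMr in Ygh].
by rewrite -(closed_connect clY (conG _ _ (group1 G) Gx)) group1.
Qed.

Lemma total_perfect_code_uniq {T : finType} {V C : {set T}} {e : rel T} {v c d} :
  total_perfect_code V e C -> v \in V ->
  c \in C -> e v c -> d \in C -> e v d -> c = d.
Proof.
move=> [_ uniqC] Vv Cc vc Cd vd; have /eqP/cards1P[b Db] := uniqC v Vv.
have: c \in [set x in C | e v x] by rewrite inE Cc.
have: d \in [set x in C | e v x] by rewrite inE Cd.
by rewrite Db !inE => /eqP-> /eqP->.
Qed.

Lemma total_perfect_code_cent_gcore {gT : finGroupType} {G H : {group gT}}
    {Y : {set gT}} :
  normal_subset G Y -> total_perfect_code G (cayley_sum G Y) H ->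
  Y \subset 'C(gcore H G).
Proof.
move=> [sYG nYG] tpcH; have sHG := tpcH.1.
apply/subsetP=> y Yy; apply/centP=> n Nn; apply/commgP/conjg_fixP.
have Gy := subsetP sYG y Yy.
have Hn := subsetP (gcore_sub H G) n Nn.
have Gn := subsetP sHG n Hn.
have Yyn: y ^ n \in Y by rewrite -(nYG n Gn) memJ_conjg.
have [Hy | H'y] := boolP (y \in H).
  (* The graph has no loops, so [y = 1] is not a neighbour of [1] and is treated apart. *)
  have [-> | nt_y] := eqVneq y 1; first by rewrite conj1g.
  apply: (total_perfect_code_uniq tpcH (group1 G)) => //.
  - by rewrite groupJ.
  - by apply/and4P; split; rewrite ?mul1g ?groupJ // eq_sym conjg_eq1.
  - by apply/and4P; split; rewrite ?mul1g // eq_sym.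
have Hyn: [~ y, n] \in H.
  apply: (subsetP (gcore_sub H G)); rewrite commgEr groupM //.
  by rewrite memJ_norm ?groupV // (subsetP (gcore_norm H G)).
have neq_y h: h \in H -> y != h by apply: contraTneq => <-.
(* The competing neighbours of [y] in [H] are [[~ y, n]] and [1]: their products with [y] are
   [y ^ n] and [y]. *)
apply/conjg_fixP/eqP; apply: (total_perfect_code_uniq tpcH Gy) => //.
  by apply/and4P; split; rewrite // ?(subsetP sHG) ?neq_y -?conjg_mulR //.
by apply/and4P; split; rewrite ?neq_y ?mulg1 //.
Qed.

Theorem theorem4p5 (gT : finGroupType) (G H : {group gT}) :
  (H \subset G)%g ->
  ~~ (gcore H G \subset 'Z(G))%g ->
  ~ exists Y : {set gT},
      [/\ normal_subset G Y,
          graph_connected G (cayley_sum G Y)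
        & total_perfect_code G (cayley_sum G Y) H].
Proof.
move=> sHG /negP not_central [Y [nYG conG tpcH]]; apply: not_central.
(* Reversing the centralising relation leaves an inclusion of [G] in a subgroup, which can be tested
   on the generators [Y]. *)
rewrite subsetI (subset_trans (gcore_sub H G)) //= centsC.
apply: subset_trans (connected_cayley_sum_gen conG) _.
by rewrite gen_subG total_perfect_code_cent_gcore.
Qed.
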